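(* Let $H$ and $K$ be locally compact groups, let $\tau:H\to Aut(K)$ be a continuous homomorphism and let $G_\tau=H\ltimes_\tau K$. Then the $\tau$-convolution $\stackrel{\tau}{\ast}$ on $L^1(G_\tau)$ is commutative if and only if $K$ is abelian.
   Context: $H,K$ have left Haar measures $dh$ (also written $dt$) and $dk$ (also $ds$). A homomorphism $\tau:H\to Aut(K)$, $h\mapsto\tau_h$, is called continuous if $(h,k)\mapsto\tau_h(k)$ is continuous from $H\times K$ to $K$. The semidirect product $G_\tau=H\ltimes_\tau K$ is the set $H\times K$ with the product topology and the operation $(h,k)\ltimes_\tau(h',k')=(hh',k\tau_h(k'))$. The continuous homomorphism $\delta:H\to(0,\infty)$ is given by $dk=\delta(h)\,d(\tau_h(k))$, i.e. $|E|=\delta(h)|\tau_h(E)|$ for Haar measure $|\cdot|$ on $K$; a left Haar measure of $G_\tau$ is $\delta(h)\,dh\,dk$, and $L^1(G_\tau)$ is taken with respect to it. For $f\in L^1(G_\tau)$ and $t\in H$ put $f_t(k)=f(t,k)$. With $\ast$ the standard convolution on $L^1(K)$, for $f,g\in L^1(G_\tau)$ put $$f\stackrel{\tau_r}{\ast}g(h,k)=\int_H f_h\ast g_t(k)\,\delta(t)\,dt,\qquad f\stackrel{\tau_l}{\ast}g(h,k)=\int_H f_t\ast g_h(k)\,\delta(t)\,dt,$$ and define the $\tau$-convolution $f\stackrel{\tau}{\ast}g=2^{-1}(f\stackrel{\tau_r}{\ast}g+f\stackrel{\tau_l}{\ast}g)$. *)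

(* Defs.v *)
From HB Require Import structures.
From mathcomp Require Import all_boot all_order all_algebra.
From mathcomp Require Import all_classical all_reals all_analysis.
From mathcomp.real_closed Require Import complex.

Set Implicit Arguments.
Unset Strict Implicit.
Unset Printing Implicit Defensive.

Import Order.TTheory GRing.Theory Num.Theory.
Import numFieldNormedType.Exports.

Local Open Scope classical_set_scope.
Local Open Scope group_scope.
Local Open Scope ring_scope.

(* The base point plays no role: it is only there because the library's
   generated sigma-algebras live on pointed types. *)
HB.mixin Record isTopologicalGroup G of PointedTopological G & Group G := {
  mulg_continuous : continuous (fun p : G * G => (p.1 * p.2)%g);
  invg_continuous : continuous (fun x : G => (x^-1)%g)
}.

#[short(type="topologicalGroupType")]
HB.structure Definition TopologicalGroup :=
  {G of PointedTopological G & Group G & isTopologicalGroup G}.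

Definition locally_compact_group (G : topologicalGroupType) : Prop :=
  hausdorff_space G /\ locally_compact [set: G].

Notation borel G := (g_sigma_algebraType (@open G)).

Section Haar.
Variables (R : realType) (G : topologicalGroupType).
Variable mu : {measure set (borel G) -> \bar R}.

(* Outer regularity on all Borel sets (rather than inner regularity) is the
   convention under which a null set of a product group has null sections
   almost everywhere, also when the groups are not sigma-compact. *)
Definition radon_measure : Prop :=
  [/\ forall C : set G, compact C -> (mu C < +oo)%E,
      forall E : set (borel G), measurable E ->
        mu E = ereal_inf [set mu U | U in [set U : set G | open U /\ E `<=` U]]
    & forall U : set G, open U ->
        mu U = ereal_sup [set mu C | C in [set C : set G | compact C /\ C `<=` U]]].

Definition left_haar_measure : Prop :=
  [/\ radon_measure, mu [set: borel G] != 0%E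
    & forall (x : G) (E : set (borel G)), measurable E ->
        mu [set (x * y)%g | y in (E : set G)] = mu E].

End Haar.

Section ComplexIntegral.
Variables (d : measure_display) (T : measurableType d) (R : realType).
Variable mu : {measure set T -> \bar R}.

Definition cintegrable (f : T -> R[i]) : Prop :=
  mu.-integrable setT (fun x => (complex.Re (f x))%:E) /\
  mu.-integrable setT (fun x => (complex.Im (f x))%:E).

Definition cintegral (f : T -> R[i]) : R[i] :=
  Complex (\int[mu]_x complex.Re (f x)) (\int[mu]_x complex.Im (f x)).

End ComplexIntegral.

Definition convolution (R : realType) (K : topologicalGroupType)
    (muK : {measure set (borel K) -> \bar R}) (u v : K -> R[i]) (k : K) : R[i] :=
  cintegral muK (fun s : borel K => u s * v ((s : K)^-1 * k)%g).

Definition topological_automorphism (K : topologicalGroupType) (f : K -> K) : Prop :=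
  [/\ {morph f : x y / (x * y)%g}, continuous f
    & exists g : K -> K, [/\ cancel f g, cancel g f & continuous g]].

Record continuousAction (H K : topologicalGroupType) := ContinuousAction {
  act :> H -> K -> K;
  act_aut : forall h, topological_automorphism (act h);
  act_hom : forall h h', act (h * h')%g =1 act h \o act h';
  act_continuous : continuous (fun p : H * K => act p.1 p.2)
}.

Definition semidirect (H K : topologicalGroupType) (tau : continuousAction H K) : Type :=
  (H * K)%type.

Section Semidirect.
Variables (H K : topologicalGroupType) (tau : continuousAction H K).
Local Notation G := (semidirect tau).

HB.instance Definition _ := Topological.copy G (H * K)%type.
HB.instance Definition _ := isPointed.Build G (1%g, 1%g).

Definition semidirect_one : G := (1%g, 1%g).
Definition semidirect_mul (x y : G) : G := ((x.1 * y.1)%g, (x.2 * tau x.1 y.2)%g).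
Definition semidirect_inv (x : G) : G := ((x.1^-1)%g, tau (x.1^-1)%g (x.2^-1)%g).

Lemma actM h : {morph tau h : x y / (x * y)%g}.
Proof. by have [] := act_aut tau h. Qed.

Lemma act1g k : tau 1%g k = k.
Proof.
have [_ _ [g [fK _ _]]] := act_aut tau 1%g.
by apply: (can_inj fK); rewrite -[LHS](act_hom tau 1%g 1%g k) mulg1.
Qed.

Lemma actg1 h : tau h 1%g = 1%g.
Proof. by apply: (mulgI (tau h 1%g)); rewrite -actM !mulg1. Qed.

Lemma semidirect_mulA : associative semidirect_mul.
Proof.
move=> x y z; rewrite /semidirect_mul /= mulgA.
by congr (_, _); rewrite actM (act_hom tau) /= mulgA.
Qed.

Lemma semidirect_mul1 : left_id semidirect_one semidirect_mul.
Proof. by case=> h k; rewrite /semidirect_mul /= act1g !mul1g. Qed.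

Lemma semidirect_mulr1 : right_id semidirect_one semidirect_mul.
Proof. by case=> h k; rewrite /semidirect_mul /= actg1 !mulg1. Qed.

Lemma semidirect_mulV : left_inverse semidirect_one semidirect_inv semidirect_mul.
Proof.
by case=> h k; rewrite /semidirect_mul /semidirect_inv /= -actM !mulVg actg1.
Qed.

Lemma semidirect_mulrV : right_inverse semidirect_one semidirect_inv semidirect_mul.
Proof.
case=> h k; rewrite /semidirect_mul /semidirect_inv /= mulgV.
by rewrite -[tau h _](act_hom tau) mulgV act1g mulgV.
Qed.

HB.instance Definition _ := isGroup.Build G semidirect_mulA semidirect_mul1
  semidirect_mulr1 semidirect_mulV semidirect_mulrV.

Local Lemma pair_continuous (S T U : topologicalType) (f : S -> T) (g : S -> U) :
  continuous f -> continuous g -> continuous (fun x => (f x, g x)).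
Proof. by move=> cf cg x; exact: cvg_pair (cf x) (cg x). Qed.

Local Lemma comp_continuous (S T U : topologicalType) (f : T -> U) (g : S -> T) :
  continuous f -> continuous g -> continuous (f \o g).
Proof. by move=> cf cg x; exact: continuous_comp (cg x) (cf (g x)). Qed.

Local Lemma fst_cont (S T : topologicalType) : continuous (@fst S T).
Proof. by move=> x; exact: cvg_fst. Qed.

Local Lemma snd_cont (S T : topologicalType) : continuous (@snd S T).
Proof. by move=> x; exact: cvg_snd. Qed.

Lemma semidirect_mul_continuous : continuous (fun p : G * G => (p.1 * p.2)%g).
Proof.
pose HK : topologicalType := (H * K)%type.
have c11 : continuous (fun p : HK * HK => p.1.1).
  by apply: comp_continuous; exact: fst_cont.
have c12 : continuous (fun p : HK * HK => p.1.2).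
  by apply: comp_continuous; [exact: snd_cont | exact: fst_cont].
have c21 : continuous (fun p : HK * HK => p.2.1).
  by apply: comp_continuous; [exact: fst_cont | exact: snd_cont].
have c22 : continuous (fun p : HK * HK => p.2.2).
  by apply: comp_continuous; exact: snd_cont.
apply: (@pair_continuous (HK * HK)%type H K (fun p => p.1.1 * p.2.1)%g
  (fun p => p.1.2 * tau p.1.1 p.2.2)%g).
  exact: (comp_continuous (@mulg_continuous H) (pair_continuous c11 c21)).
apply: (comp_continuous (@mulg_continuous K) (pair_continuous c12 _)).
exact: (comp_continuous (act_continuous (c := tau)) (pair_continuous c11 c22)).
Qed.

Lemma semidirect_inv_continuous : continuous (fun x : G => (x^-1)%g).
Proof.
pose HK : topologicalType := (H * K)%type.
have c1 : continuous (fun p : HK => (p.1^-1)%g).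
  exact: (comp_continuous (@invg_continuous H) (@fst_cont H K)).
have c2 : continuous (fun p : HK => (p.2^-1)%g).
  exact: (comp_continuous (@invg_continuous K) (@snd_cont H K)).
apply: (@pair_continuous HK H K (fun p => p.1^-1)%g
  (fun p => tau (p.1^-1) (p.2^-1))%g) => //.
exact: (comp_continuous (act_continuous (c := tau)) (pair_continuous c1 c2)).
Qed.

HB.instance Definition _ := isTopologicalGroup.Build G
  semidirect_mul_continuous semidirect_inv_continuous.

End Semidirect.

Section TauConvolution.
Variables (R : realType) (H K : topologicalGroupType) (tau : continuousAction H K).
Variables (muH : {measure set (borel H) -> \bar R}).
Variables (muK : {measure set (borel K) -> \bar R}).
Variable delta : H -> R.
Local Notation G := (semidirect tau).

Definition modular_factor : Prop :=
  [/\ forall h, 0 < delta h,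
      forall h h', delta (h * h')%g = delta h * delta h',
      continuous delta
    & forall (h : H) (E : set (borel K)), measurable E ->
        muK E = ((delta h)%:E * muK [set tau h k | k in (E : set K)])%E].

(* mu is the measure delta(h) dh dk. A product measure in the sense of
   sigma-algebras would not do: without second countability the Borel sets of
   H * K need not be generated by measurable rectangles. As usual for Radon
   products, the measure is determined by its integrals over compactly
   supported continuous functions. *)
Definition semidirect_haar_measure (mu : {measure set (borel G) -> \bar R}) : Prop :=
  left_haar_measure mu /\
  forall phi : G -> R, continuous phi -> compact (closure [set x | phi x != 0]) ->
    \int[mu]_x phi x =
    \int[muH]_h (\int[muK]_k (phi ((h : H), (k : K)) * delta h)).

Definition slice (f : G -> R[i]) (t : H) : K -> R[i] := fun k => f (t, k).

Definition tau_conv_r (f g : G -> R[i]) (x : G) : R[i] :=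
  cintegral muH (fun t : borel H =>
    convolution muK (slice f x.1) (slice g t) x.2 * (delta t)%:C%C).

Definition tau_conv_l (f g : G -> R[i]) (x : G) : R[i] :=
  cintegral muH (fun t : borel H =>
    convolution muK (slice f t) (slice g x.1) x.2 * (delta t)%:C%C).

Definition tau_conv (f g : G -> R[i]) (x : G) : R[i] :=
  2^-1 * (tau_conv_r f g x + tau_conv_l f g x).

End TauConvolution.

(* Main.v *)
From HB Require Import structures.
Require Import Defs.
From mathcomp Require Import all_boot all_order all_algebra finmap.
From mathcomp Require Import all_classical all_reals all_analysis.
From mathcomp Require Import measurable_realfun lra.
From mathcomp.real_closed Require Import complex.

Set Implicit Arguments.
Unset Strict Implicit.
Unset Printing Implicit Defensive.

Import Order.TTheory GRing.Theory Num.Theory.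
Import numFieldNormedType.Exports.
Import HBNNSimple.
Local Open Scope classical_set_scope.
Local Open Scope ring_scope.

(** If K is abelian, its Haar measure is invariant under inversion, hence under
    every reflection s |-> s^-1 k.  Substituting s^-1 k for s in the integral
    defining u * v (k) exchanges the two factors, so that u * v = v * u at every
    point and for all functions u, v on K ([abelian_convolutionC]).  Therefore
    the right part of the tau-convolution of f and g is the left part of that of
    g and f, and the average of both parts is symmetric.  The substitution is
    made in the definition of the integral itself: a measurable involution that
    preserves the measure permutes the simple functions and preserves their
    integrals ([integral_involution]).

    Inversion invariance ([haar_abelian_inv]) is usually drawn from the
    uniqueness of the Haar measure.  Here it comes from computing, for sets D
    and E, the measure of the set of pairs (d, y) with d in D and y^-1 d in E in
    two ways.  Exact equality would be a case of Fubini, but the product of two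
    Borel sigma-algebras is too small for that in general.  Cutting D and E into
    pieces of the size of a small neighbourhood V of 1 bounds the function
    y |-> mu (D \cap y E) from below and from above by step functions, and
    comparing their integrals gives the inequality of [haar_abelian_compare].
    Regularity of the measure removes the error committed on the scale of V.

    Conversely, let x y <> y x.  There are small neighbourhoods U of x and W of y
    such that U W and W U are disjoint.  With A a small neighbourhood of 1 in H,
    take for f and g the indicator functions of A x U and A x W.  On the open set
    A x U W the tau-convolution of f and g is positive, because the measure of
    U \cap k W^-1 is positive for k in U W, while that of g and f vanishes there.
    Nonempty open sets have positive Haar measure ([haar_open_gt0]), so the two
    do not agree almost everywhere. *)

(** * Borel sets and compact sets of a topological group *)

Section TopologicalGroup.
Context {G : topologicalGroupType}.
Implicit Types (x y : G) (A C D U V : set G).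

Lemma open_borel (T : ptopologicalType) (U : set T) :
  open U -> measurable (U : set (borel T)).
Proof. exact: sub_sigma_algebra. Qed.

Lemma preimage_borel (S T : ptopologicalType) (f : S -> T) (E : set T) :
  continuous f -> measurable (E : set (borel T)) ->
  measurable (f @^-1` E : set (borel S)).
Proof.
move=> cf mE; rewrite -[f @^-1` E]setTI.
have : measurable_fun [set: borel S] (f : borel S -> borel T).
  apply: measurability => // _ [U oU <-]; rewrite setTI.
  by apply: open_borel; apply: open_comp => // z _; exact: cf.
by apply.
Qed.

Lemma compact_borel C :
  hausdorff_space G -> compact C -> measurable (C : set (borel G)).
Proof.
move=> hG cC; rewrite -[C]setCK; apply: measurableC; apply: open_borel.
by rewrite openC; exact: compact_closed.
Qed.

Lemma mulg2_continuous (T : topologicalType) (f g : T -> G) :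
  continuous f -> continuous g -> continuous (fun t => (f t * g t)%g).
Proof.
move=> cf cg t; apply: (@continuous_comp _ _ _ (fun t => (f t, g t))
  (fun p : G * G => (p.1 * p.2)%g)); first exact: cvg_pair (cf t) (cg t).
by move: (mulg_continuous (f t, g t)).
Qed.

Lemma invg_comp_continuous (T : topologicalType) (f : T -> G) :
  continuous f -> continuous (fun t => (f t)^-1%g).
Proof.
move=> cf t; apply: (@continuous_comp _ _ _ f (fun x => x^-1%g)); first exact: cf.
by move: (invg_continuous (f t)).
Qed.

Lemma mulgl_continuous x : continuous (fun y => (x * y)%g).
Proof. by apply: mulg2_continuous => t; [exact: cvg_cst|exact: cvg_id]. Qed.

(** The map f is a perturbation of the identity by v, such as multiplication by
    v or by v^-1 on either side; by compactness the neighbourhoods of 1 given by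
    continuity at the points of C can be chosen uniformly. *)
Lemma compact_shrink (f : G -> G -> G) C U :
  continuous (fun p : G * G => f p.1 p.2) -> (forall c, f 1%g c = c) ->
  compact C -> open U -> C `<=` U ->
  \forall v \near 1%g, forall c, C c -> U (f v c).
Proof.
move=> cf f1 /compact_near_coveringP cC oU CU.
apply: (cC _ (nbhs 1%g) (fun v c => U (f v c))) => c Cc.
have : nbhs ((1%g : G), c) (fun p => U (f p.1 p.2)).
  by apply: cf; rewrite /= f1; apply: open_nbhs_nbhs; split => //; exact: CU.
case=> -[P Q] /= [P1 Qc] PQ; exists (Q, P) => //= -[a b] /= [Qa Pb].
exact: (PQ (b, a)).
Qed.

Lemma compact_translate_cover C V : compact C -> open V -> V 1%g ->
  exists (n : nat) (x : nat -> G),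
    forall c, C c -> exists2 i, (i < n)%N & V ((x i)^-1 * c)%g.
Proof.
rewrite compact_cover => cC oV V1.
have [] := cC G C (fun x => (fun c => x^-1 * c)%g @^-1` V).
- by move=> x _; apply: open_comp => // z _; exact: mulgl_continuous.
- by move=> c Cc; exists c => //=; rewrite mulVg.
move=> s _ Cs; exists (size (enum_fset s)), (nth 1%g (enum_fset s)).
move=> c /Cs[x sx Vx].
by exists (index x (enum_fset s)); [rewrite index_mem|rewrite nth_index].
Qed.

Lemma locally_compact_group_nbhs x : locally_compact_group G ->
  exists2 C : set G, compact C & nbhs x C.
Proof.
move=> [_ /(_ x I)[U xU [cU _]]]; exists U => //.
exact: (filterS (fun y (h : setT y -> U y) => h I) xU).
Qed.

End TopologicalGroup.

(** * Integrals of step functions *)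

Section StepFunction.
Local Open Scope ereal_scope.
Context {d : measure_display} {T : measurableType d} {R : realType}.
Variables (mu : {measure set T -> \bar R}) (k : nat).
Variables (w : nat -> \bar R) (Q : nat -> set T).
Hypotheses (w_ge0 : forall i, 0 <= w i) (mQ : forall i, measurable (Q i)).

Definition step_function (y : T) : \bar R := \sum_(i < k) (w i * (\1_(Q i) y)%:E).

Lemma step_function_ge0 y : 0 <= step_function y.
Proof. by apply: sume_ge0 => i _; apply: mule_ge0 => //; rewrite lee_fin. Qed.

Let measurable_summand i :
  measurable_fun setT (fun y : T => w i * (\1_(Q i) y)%:E).
Proof.
by apply: measurable_funeM; apply: measurableT_comp => //; exact: measurable_indic.
Qed.

Lemma measurable_step_function : measurable_fun setT step_function.
Proof. by apply: emeasurable_sum => i. Qed.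

Lemma integral_step (b : \bar R) : (forall i, mu (Q i) = b) ->
  \int[mu]_y step_function y = (\sum_(i < k) w i) * b.
Proof.
move=> Qb; rewrite ge0_integral_sum //=; last first.
  by move=> i y _; apply: mule_ge0 => //; rewrite lee_fin.
rewrite ge0_sume_distrl //; apply: eq_bigr => i _.
rewrite ge0_integralZl //; first by rewrite integral_indic // setIT Qb.
by apply: measurableT_comp => //; exact: measurable_indic.
Qed.

End StepFunction.

(** * Left Haar measures *)

Section LeftHaar.
Context {R : realType} {G : topologicalGroupType}.
Variable mu : {measure set (borel G) -> \bar R}.
Hypothesis haar : left_haar_measure mu.
Implicit Types (x y : G) (A C D U V : set G).

Lemma haar_preimage x (E : set G) : measurable (E : set (borel G)) ->
  mu ((fun y : G => (x * y)%g) @^-1` E) = mu E.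
Proof.
have [_ _ inv] := haar => mE; rewrite -(inv x^-1%g _ mE); congr (mu _).
apply/seteqP; split => [y Ey|_ [y Ey <-]] /=; last by rewrite mulVKg.
by exists (x * y)%g => //; rewrite mulKg.
Qed.

(** If U were null, so would be every compact set, being covered by finitely many
    translates of U, and then by inner regularity the whole group. *)
Lemma haar_open_gt0 U x : hausdorff_space G -> open U -> U x -> (0 < mu U)%E.
Proof.
move=> hG oU Ux; rewrite lt_neqAle measure_ge0 andbT eq_sym.
apply/eqP => U0; have [[_ _ inner] muT _] := haar; case/eqP: muT.
rewrite inner; last exact: openT.
apply/eqP; rewrite eq_le; apply/andP; split; last first.
  apply: ereal_sup_ubound => /=; exists set0; rewrite ?measure0 //.
  by split=> //; exact: compact0.
apply: ge_ereal_sup => _ [C [cC _] <-].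
have oV : open ((fun y => (x * y)%g) @^-1` U).
  by apply: open_comp => // z _; exact: mulgl_continuous.
have V1 : ((fun y => (x * y)%g) @^-1` U) 1%g by rewrite /= mulg1.
have [n [s Cs]] := compact_translate_cover cC oV V1.
pose F i : set G := (fun c : G => ((x * (s i)^-1) * c)%g) @^-1` U.
have mF i : measurable (F i : set (borel G)).
  by apply: preimage_borel; [exact: mulgl_continuous|exact: open_borel].
have CF : C `<=` \big[setU/set0]_(i < n) F i.
  move=> c /Cs[i ltin Vi]; rewrite -bigcup_mkord; exists i => //.
  by rewrite /F /= -mulgA.
have mC : measurable (C : set (borel G)) by exact: compact_borel.
apply: le_trans (content_subadditive mu (fun i _ => mF i) mC CF) _.
rewrite big1 // => i _; exact: etrans (haar_preimage _ (open_borel oU)) U0.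
Qed.

Lemma haar_open_gt0_lty U x : locally_compact_group G -> open U -> U x ->
  (exists2 C, compact C & U `<=` C) -> (0 < mu U < +oo)%E.
Proof.
move=> [hG _] oU Ux [C cC UC]; rewrite (haar_open_gt0 hG oU Ux) /=.
have [[fin _ _] _ _] := haar; apply: le_lt_trans (fin _ cC).
apply: le_measure; rewrite ?inE //; first exact: open_borel.
exact: compact_borel.
Qed.

(** A set covered by the translates x_i V is the disjoint union of Borel pieces
    contained in these translates. *)
Lemma haar_pieces (D V : set G) (n : nat) (x : nat -> G) :
  measurable (D : set (borel G)) -> open V ->
  (forall d, D d -> exists2 i, (i < n)%N & V ((x i)^-1 * d)%g) ->
  exists F : nat -> set (borel G),
    [/\ forall i, measurable (F i), forall i d, F i d -> D d /\ V ((x i)^-1 * d)%g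
      & forall B : set (borel G), measurable B ->
        mu (D `&` B) = (\sum_(i < n) mu (F i `&` B))%E].
Proof.
move=> mD oV Dx; pose P i : set G := D `&` (fun d => ((x i)^-1 * d)%g) @^-1` V.
have mP i : measurable (P i : set (borel G)).
  apply: measurableI => //.
  by apply: preimage_borel; [exact: mulgl_continuous|exact: open_borel].
have mF i : measurable (seqDU P i : set (borel G)).
  apply: measurableD => //; apply: bigsetU_measurable => j _; exact: mP.
exists (seqDU P); split => [//|i d [] //|B mB].
have -> : (D : set (borel G)) `&` B = \big[setU/set0]_(i < n) (seqDU P i `&` B).
  rewrite -big_distrl /= -bigsetU_seqDU; congr (_ `&` _).
  rewrite -bigcup_mkord; apply/seteqP; split => [d Dd|d [i _ [] //]].
  by have [i ltin Vi] := Dx d Dd; exists i.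
apply: (measure_bigsetU mu (F := fun i => (seqDU P i : set (borel G)) `&` B)).
  by move=> i; exact: measurableI.
exact: trivIset_setIr (trivIset_seqDU P).
Qed.

(** For D_i the pieces of D and E_j those of E,
    sum_i mu (D_i) 1[x_i^-1 y \in C] <= mu (D \cap y E) = mu (y^-1 D \cap E)
      <= sum_j mu (E_j) 1[z_j y \in D'];
    integrating over y gives mu (D) mu (C) on the left and mu (E) mu (D') on the
    right.  Here E is slightly larger than C^-1 and D' slightly larger than D.
    Commutativity turns the condition y z_j \in D' into z_j y \in D', which
    defines a left translate of D'. *)
Lemma haar_abelian_compare (C D D' E V : set G) (n m : nat) (x z : nat -> G) :
  (forall x y : G, commute x y) ->
  measurable (C : set (borel G)) -> measurable (D : set (borel G)) ->
  measurable (D' : set (borel G)) -> measurable (E : set (borel G)) -> open V ->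
  (forall d, D d -> exists2 i, (i < n)%N & V ((x i)^-1 * d)%g) ->
  (forall e, E e -> exists2 j, (j < m)%N & V ((z j)^-1 * e)%g) ->
  (forall c v, C c -> V v -> E (c^-1 * v)%g) ->
  (forall d v, D d -> V v -> D' (d * v^-1)%g) ->
  (mu D * mu C <= mu E * mu D')%E.
Proof.
move=> ab mC mD mD' mE oV Dx Ez CVE DVD'.
have [F [mF FV muF]] := haar_pieces mD oV Dx.
have [F' [mF' FV' muF']] := haar_pieces mE oV Ez.
pose S i : set (borel G) := (fun y : G => ((x i)^-1 * y)%g) @^-1` C.
pose T j : set (borel G) := (fun y : G => (z j * y)%g) @^-1` D'.
have mS i : measurable (S i).
  by apply: preimage_borel => //; exact: mulgl_continuous.
have mT j : measurable (T j).
  by apply: preimage_borel => //; exact: mulgl_continuous.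
have -> : mu D = (\sum_(i < n) mu (F i))%E.
  by rewrite -[X in mu X]setIT muF //; apply: eq_bigr => i _; rewrite setIT.
have -> : mu E = (\sum_(j < m) mu (F' j))%E.
  by rewrite -[X in mu X]setIT muF' //; apply: eq_bigr => i _; rewrite setIT.
rewrite -(integral_step (mu := mu) n (fun i => measure_ge0 mu (F i)) mS);
  last by move=> i; exact: haar_preimage.
rewrite -(integral_step (mu := mu) m (fun j => measure_ge0 mu (F' j)) mT);
  last by move=> j; exact: haar_preimage.
apply: ge0_le_integral => //.
- by move=> y _; exact: step_function_ge0.
- exact: measurable_step_function.
- exact: measurable_step_function.
move=> y _.
have mEy : measurable ((fun d : G => (y^-1 * d)%g) @^-1` E : set (borel G)).
  by apply: preimage_borel => //; exact: mulgl_continuous.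
have mDy : measurable ((fun e : G => (y * e)%g) @^-1` D : set (borel G)).
  by apply: preimage_borel => //; exact: mulgl_continuous.
apply: (@le_trans _ _ (mu (D `&` (fun d : G => (y^-1 * d)%g) @^-1` E))).
  (* If y = x_i c and d = x_i v, then y^-1 d = c^-1 v lies in E. *)
  rewrite (muF _ mEy); apply: lee_sum => i _; rewrite indicE.
  case: (boolP (y \in S i)) => [|_]; last by rewrite mule0.
  rewrite inE mule1 => Sy; apply: le_measure; rewrite ?inE //.
    by apply: measurableI.
  move=> d Fd; split=> //=; have [Dd Vd] := FV _ _ Fd.
  have := CVE _ _ Sy Vd; rewrite invgM invgK -mulgA mulVKg; exact.
rewrite -(haar_preimage y); last exact: measurableI.
have -> : (fun z : G => (y * z)%g) @^-1`
      (D `&` (fun d : G => (y^-1 * d)%g) @^-1` E) =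
    E `&` (fun e : G => (y * e)%g) @^-1` D.
  by apply/seteqP; split => e /=; rewrite mulKg => -[].
(* If e = z_j v and y e lies in D, then y z_j = (y e) v^-1 lies in D'. *)
rewrite (muF' _ mDy); apply: lee_sum => j _; rewrite indicE.
case: (boolP (y \in T j)) => [_|]; rewrite ?mule1.
  by apply: le_measure; rewrite ?inE //; exact: measurableI.
rewrite notin_setE => nTy; rewrite (_ : F' j `&` _ = set0) ?measure0 ?mule0 //.
apply/seteqP; split => // e [Fe Dye]; apply: nTy; have [_ Ve] := FV' _ _ Fe.
have := DVD' _ _ Dye Ve; rewrite /T /= invgM invgK mulgA (ab (z j) y).
by rewrite -(mulgA y) mulgV mulg1.
Qed.

End LeftHaar.

(** * Inversion invariance on abelian groups *)

Section AbelianHaar.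
Context {R : realType} {G : topologicalGroupType}.
Variable mu : {measure set (borel G) -> \bar R}.
Hypotheses (haar : left_haar_measure mu) (lcG : locally_compact_group G).
Hypothesis ab : forall x y : G, commute x y.
Implicit Types (x y : G) (C D U V : set G).

Lemma haar_compact_fin C : compact C -> mu C \is a fin_num.
Proof.
by move=> cC; have [[fin _ _] _ _] := haar; rewrite ge0_fin_numE // fin.
Qed.

Lemma haar_nbhs_gt0 x U : nbhs x U -> measurable (U : set (borel G)) ->
  (0 < mu U)%E.
Proof.
move=> xU mU; have [hG _] := lcG.
apply: (@lt_le_trans _ _ (mu (U^° : set G))).
  by apply: (haar_open_gt0 haar hG (x := x)); [exact: open_interior|].
apply: le_measure; rewrite ?inE //; first exact: open_borel (open_interior _).
exact: interior_subset.
Qed.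

(** The choice E = C^-1 V in [haar_abelian_compare], for V small enough that
    E^-1 is contained in U and D V^-1 in D', and that E is covered by finitely
    many translates of V. *)
Lemma haar_abelian_cross C D D' U :
  compact C -> compact D -> open D' -> D `<=` D' -> open U -> C `<=` U ->
  (mu D * mu C <= mu ((fun x : G => x^-1%g) @^-1` U) * mu D')%E.
Proof.
move=> cC cD oD' DD' oU CU; have [hG _] := lcG.
have fC : continuous (fun p : G * G => (p.1^-1 * p.2)%g).
  apply: mulg2_continuous; last by move=> p; exact: cvg_snd.
  by apply: invg_comp_continuous => p; exact: cvg_fst.
have fD : continuous (fun p : G * G => (p.2 * p.1^-1)%g).
  apply: mulg2_continuous; first by move=> p; exact: cvg_snd.
  by apply: invg_comp_continuous => p; exact: cvg_fst.
have [N cN N1] := locally_compact_group_nbhs 1%g lcG.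
have VU := compact_shrink (f := fun v c => (v^-1 * c)%g) fC _ cC oU CU.
have VD := compact_shrink (f := fun v d => (d * v^-1)%g) fD _ cD oD' DD'.
have : nbhs 1%g ((N `&` (fun v => forall c, C c -> U (v^-1 * c)%g)) `&`
    (fun v => forall d, D d -> D' (d * v^-1)%g)).
  apply: filterI; first apply: filterI => //.
    by apply: VU => c; rewrite invg1 mul1g.
  by apply: VD => c; rewrite invg1 mulg1.
rewrite nbhsE => -[V [oV V1] VW].
pose E : set G := \bigcup_(c in C) (fun e => (c * e)%g) @^-1` V.
have oE : open E.
  apply: bigcup_open => c _; apply: open_comp => // z _; exact: mulgl_continuous.
have cP : compact [set (p.1^-1 * p.2)%g | p in C `*` N].
  apply: continuous_compact; last exact: compact_setX.
  exact: continuous_subspaceT.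
have [n [x Dx]] := compact_translate_cover cD oV V1.
have [m [z Pz]] := compact_translate_cover cP oV V1.
apply: (@le_trans _ _ (mu E * mu D')%E).
  apply: (haar_abelian_compare haar (V := V) (n := n) (m := m)
    (x := x) (z := z)) => //.
  - exact: compact_borel.
  - exact: compact_borel.
  - exact: open_borel.
  - exact: open_borel.
  - move=> e [c Cc Ve]; apply: Pz; exists (c, (c * e)%g); last by rewrite /= mulKg.
    by split=> //=; have [[]] := VW _ Ve.
  - by move=> c v Cc Vv; exists c => //=; rewrite mulVKg.
  - by move=> d v Dd Vv; have [_] := VW _ Vv; exact.
apply: lee_wpmul2r => //; apply: le_measure; rewrite ?inE.
- exact: open_borel.
- apply: preimage_borel; last exact: open_borel.
  by apply: invg_comp_continuous => p; exact: cvg_id.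
move=> e [c Cc Ve] /=; have [[_ Ue] _] := VW _ Ve.
by have := Ue _ Cc; rewrite invgM mulgVK.
Qed.

(** Any compact D of positive measure will do in [haar_abelian_cross]: by outer
    regularity mu (D') can be made close to mu (D), which then cancels. *)
Lemma haar_abelian_compact_le C U : compact C -> open U -> C `<=` U ->
  (mu C <= mu ((fun x : G => x^-1%g) @^-1` U))%E.
Proof.
move=> cC oU CU; have [hG _] := lcG.
have [D cD D1] := locally_compact_group_nbhs 1%g lcG.
have mD := compact_borel hG cD.
have D0 := haar_nbhs_gt0 D1 mD.
have cross D' := @haar_abelian_cross C D D' U cC cD.
have [[_ outer _] _ _] := haar.
have := outer _ mD.
move: D0 (haar_compact_fin cD) (haar_compact_fin cC) cross.
set u := mu (_ @^-1` U); have : (0 <= u)%E by exact: measure_ge0.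
case: u => [u| |] //; last by move=> *; exact: leey.
rewrite lee_fin => u0; case: (mu D) => [d| |] //; rewrite lte_fin => d0 _.
have : (0 <= mu C)%E by exact: measure_ge0.
case: (mu C) => [c| |] //; rewrite lee_fin => c0 _ cross dE.
rewrite leNgt lte_fin; apply/negP => uc.
(* If u < c, then d c <= u mu (D') <= w mu (D') for all D', so that mu (D) would
   be at least d c / w > d.  Dividing by w instead of u covers the case u = 0. *)
pose w := (u + c) / 2; have uw : u < w by rewrite /w; lra.
have w0 : 0 < w by lra.
have wc : w < c by rewrite /w; lra.
suff: ((d * c / w)%:E <= d%:E)%E.
  by rewrite lee_fin ler_pdivrMr // ler_pM2l // leNgt wc.
rewrite dE; apply: le_ereal_inf_tmp => _ [D' [oD' DD'] <-].
have := cross _ oD' DD'; have : (0 <= mu D')%E by exact: measure_ge0.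
case: (mu D') => [m| |] //; last by move=> *; exact: leey.
rewrite -!EFinM !lee_fin => m0 le; rewrite ler_pdivrMr //.
by apply: (le_trans (le oU CU)); rewrite mulrC ler_wpM2l // ltW.
Qed.

Lemma haar_abelian_open_inv U : open U ->
  mu ((fun x : G => x^-1%g) @^-1` U) = mu U.
Proof.
have open_inv W : open W -> open ((fun x : G => x^-1%g) @^-1` W).
  by apply: open_comp => // z _; apply: invg_comp_continuous => p; exact: cvg_id.
have le W : open W -> (mu W <= mu ((fun x : G => x^-1%g) @^-1` W))%E.
  move=> oW; have [[_ _ inner] _ _] := haar; rewrite inner //.
  by apply: ge_ereal_sup => _ [C [cC CW] <-]; exact: haar_abelian_compact_le.
move=> oU; apply/eqP; rewrite eq_le le // andbT.
have := le _ (open_inv _ oU); congr (_ <= mu _)%E.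
by apply/seteqP; split => x /=; rewrite invgK.
Qed.

Lemma haar_abelian_inv (E : set G) : measurable (E : set (borel G)) ->
  mu ((fun x : G => x^-1%g) @^-1` E) = mu E.
Proof.
have mI A : measurable (A : set (borel G)) ->
    measurable ((fun x : G => x^-1%g) @^-1` A : set (borel G)).
  by apply: preimage_borel; apply: invg_comp_continuous => p; exact: cvg_id.
have le A : measurable (A : set (borel G)) ->
    (mu ((fun x : G => x^-1%g) @^-1` A) <= mu A)%E.
  move=> mA; have [[_ outer _] _ _] := haar; rewrite (outer _ mA).
  apply: le_ereal_inf_tmp => _ [U [oU AU] <-]; rewrite -(haar_abelian_open_inv oU).
  apply: le_measure; rewrite ?inE; [exact: mI|exact: mI (open_borel oU)|].
  by move=> x; exact: AU.
move=> mE; apply/eqP; rewrite eq_le le //=.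
have := le _ (mI _ mE); congr (mu _ <= _)%E.
by apply/seteqP; split => x /=; rewrite invgK.
Qed.

End AbelianHaar.

(** * Commutativity of convolution on abelian groups *)

Section InvolutionIntegral.
Local Open Scope ereal_scope.
Context {d : measure_display} {T : measurableType d} {R : realType}.
Variables (mu : {measure set T -> \bar R}) (phi : T -> T).
Hypotheses (mphi : measurable_fun [set: T] phi) (phiK : involutive phi).
Hypothesis mu_phi : forall A, measurable A -> mu (phi @^-1` A) = mu A.

Let sfun_comp (h : {nnsfun T >-> R}) : T -> R := h \o phi.

HB.instance Definition _ h := @isMeasurableFun.Build _ _ T R (sfun_comp h)
  (measurableT_comp (measurable_funPT h) mphi).

HB.instance Definition _ h := @FiniteImage.Build T R (sfun_comp h)
  (sub_finite_set (fun _ '(ex_intro2 x _ e) => ex_intro2 _ _ (phi x) I e) (fimfunP h)).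

HB.instance Definition _ h := @isNonNegFun.Build T R (sfun_comp h)
  (fun x => @fun_ge0 T R h (phi x)).

Let nnsfun_comp (h : {nnsfun T >-> R}) : {nnsfun T >-> R} := sfun_comp h.

Let sintegral_comp h : sintegral mu (nnsfun_comp h) = sintegral mu h.
Proof.
rewrite !sintegralET; apply: eq_fsbigr => x _; congr (_ * _).
by rewrite -[RHS]mu_phi // -[X in measurable X]setTI; exact: measurable_funPT.
Qed.

Let ge0_integral_comp (f : T -> \bar R) : (forall x, 0 <= f x) ->
  \int[mu]_x f (phi x) = \int[mu]_x f x.
Proof.
have le g : (forall x, 0 <= g x) -> \int[mu]_x g x <= \int[mu]_x g (phi x).
  move=> g0; rewrite !ge0_integralTE //; apply: ge_ereal_sup => _ [h /= hg <-].
  apply: ereal_sup_ubound; exists (nnsfun_comp h) => [x|]; first exact: hg.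
  exact: sintegral_comp.
move=> f0; apply/eqP; rewrite eq_le [X in _ && X]le // andbT.
have := le (f \o phi) (fun x => f0 (phi x)); congr (_ <= _).
by apply: eq_integral => x _ /=; rewrite phiK.
Qed.

(** Precomposition with phi maps the simple functions below f onto those below
    the composite of f and phi, for f >= 0, so that both integrals are suprema of
    the same set of values; the general case follows by positive and negative
    parts. *)
Lemma integral_involution (f : T -> \bar R) :
  \int[mu]_x f (phi x) = \int[mu]_x f x.
Proof.
rewrite [LHS]integralE [RHS]integralE; congr (_ - _).
  rewrite -(ge0_integral_comp (funepos_ge0 f)).
  by apply: eq_integral => x _; rewrite !funeposE.
rewrite -(ge0_integral_comp (funeneg_ge0 f)).
by apply: eq_integral => x _; rewrite !funenegE.
Qed.

End InvolutionIntegral.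

Lemma abelian_convolutionC (R : realType) (K : topologicalGroupType)
    (muK : {measure set (borel K) -> \bar R}) (u v : K -> R[i]) :
  left_haar_measure muK -> locally_compact_group K ->
  (forall x y : K, commute x y) ->
  convolution muK u v = convolution muK v u.
Proof.
move=> haar lcK ab; apply/funext => k.
pose phi (s : borel K) : borel K := ((s : K)^-1 * k)%g.
have cphi : continuous (phi : K -> K).
  apply: mulg2_continuous => [|t]; last exact: cvg_cst.
  by apply: invg_comp_continuous => t; exact: cvg_id.
have phiK : involutive phi by move=> s; rewrite /phi invgM invgK (ab k^-1%g s) mulgVK.
have mphi : measurable_fun [set: borel K] phi.
  by move=> _ E mE; rewrite setTI; exact: preimage_borel.
have mu_phi (A : set (borel K)) : measurable A -> muK (phi @^-1` A) = muK A.
  move=> mA; pose kA : set K := (fun y : K => (k * y)%g) @^-1` A.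
  have mkA : measurable (kA : set (borel K)).
    by apply: preimage_borel => //; exact: mulgl_continuous.
  rewrite -(haar_preimage haar k mA) -(haar_abelian_inv haar lcK ab mkA).
  by congr (muK _); apply/seteqP; split => s; rewrite /kA /= /phi (ab k).
have phiE s : ((phi s : K)^-1 * k)%g = s := phiK s.
rewrite /convolution /cintegral /Rintegral.
by congr (Complex (fine _) (fine _)); rewrite -(integral_involution mphi phiK mu_phi);
  apply: eq_integral => s _; rewrite phiE mulrC.
Qed.

Lemma abelian_tau_convC (R : realType) (H K : topologicalGroupType)
    (tau : continuousAction H K) (muH : {measure set (borel H) -> \bar R})
    (muK : {measure set (borel K) -> \bar R}) (delta : H -> R)
    (f g : semidirect tau -> R[i]) (x : semidirect tau) :
  left_haar_measure muK -> locally_compact_group K ->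
  (forall x y : K, commute x y) ->
  tau_conv muH muK delta f g x = tau_conv muH muK delta g f x.
Proof.
move=> haarK lcK ab.
have swap u v : tau_conv_r muH muK delta u v x = tau_conv_l muH muK delta v u x.
  rewrite /tau_conv_r /tau_conv_l; congr cintegral; apply/funext => t.
  by rewrite (abelian_convolutionC _ _ haarK lcK ab).
by rewrite /tau_conv !swap addrC.
Qed.

(** * Real-valued integrands *)

Section RealComplexIntegral.
Context {d : measure_display} {T : measurableType d} {R : realType}.
Variable mu : {measure set T -> \bar R}.

Lemma cintegral_real (F : T -> R) :
  cintegral mu (fun x => (F x)%:C%C) = (\int[mu]_x F x)%:C%C.
Proof. by rewrite /cintegral /=; congr Complex; rewrite /Rintegral integral0. Qed.

(** The lower bound makes the extended integral positive; the upper bound makes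
    it finite, without which its real value would be 0. *)
Lemma Rintegral_pinched_gt0 (A : set T) (F : T -> R) (lo hi : R) :
  measurable A -> (0 < mu A < +oo)%E -> measurable_fun setT F ->
  0 < lo -> (forall x, lo * \1_A x <= F x <= hi * \1_A x) ->
  0 < \int[mu]_x F x.
Proof.
move=> mA /andP[A0 Aoo] mF lo0 FA.
have mI (c : R) : measurable_fun setT (fun x : T => (c * \1_A x)%:E).
  by apply/measurable_EFinP; apply: measurable_funM => //; exact: measurable_indic.
have mFE : measurable_fun setT (fun x : T => (F x)%:E) by exact/measurable_EFinP.
have F0 x : 0 <= F x.
  by have /andP[le _] := FA x; apply: le_trans le; rewrite mulr_ge0 // ltW.
have int_indic (c : R) : 0 <= c -> (\int[mu]_x (c * \1_A x)%:E = c%:E * mu A)%E.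
  move=> c0; under eq_integral do rewrite EFinM.
  rewrite ge0_integralZl //; first by rewrite integral_indic // setIT.
  by apply/measurable_EFinP; exact: measurable_indic.
have [x Ax] : exists x, A x.
  by apply/set0P/eqP => A_0; rewrite A_0 measure0 ltxx in A0.
have hi0 : 0 <= hi.
  have /andP[le1 le2] := FA x; move: le1 le2; rewrite indicE mem_set // !mulr1.
  by move=> le1 le2; apply: le_trans (le_trans le1 le2); exact: ltW.
have lb : (lo%:E * mu A <= \int[mu]_x (F x)%:E)%E.
  rewrite -(int_indic lo (ltW lo0)); apply: ge0_le_integral => //.
    by move=> y _; rewrite lee_fin mulr_ge0 // ltW.
  by move=> y _; rewrite lee_fin; have /andP[] := FA y.
have ub : (\int[mu]_x (F x)%:E <= hi%:E * mu A)%E.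
  rewrite -(int_indic hi hi0); apply: ge0_le_integral => //.
    by move=> y _; rewrite lee_fin.
  by move=> y _; rewrite lee_fin; have /andP[] := FA y.
rewrite /Rintegral fine_gt0 //; apply/andP; split.
  by apply: lt_le_trans lb; rewrite mule_gt0 ?lte_fin.
by apply: le_lt_trans ub _; rewrite lte_mul_pinfty ?lee_fin.
Qed.

Lemma cintegrable_indic (A : set T) : measurable A -> (mu A < +oo)%E ->
  cintegrable mu (fun x => (\1_A x : R)%:C%C).
Proof.
move=> mA Aoo; split; last exact: integrable0.
apply/integrableP; split.
  by apply/measurable_EFinP; exact: measurable_indic.
under eq_integral do rewrite /= ger0_norm //.
by rewrite integral_indic // setIT.
Qed.

End RealComplexIntegral.

Lemma measurable_continuous_real (R : realType) (G : topologicalGroupType)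
  (f : G -> R) : continuous f -> measurable_fun [set: borel G] (f : borel G -> R).
Proof.
move=> cf; apply: (measurability (RGenOInfty.G (R := R))).
  exact: RGenOInfty.measurableE.
move=> _ [_ [a ->] <-]; rewrite setTI; apply: open_borel.
apply: open_comp => [x _|]; [exact: cf|exact: interval_open].
Qed.

(** * The tau-convolution of indicators of boxes *)

Lemma open_setX (S T : topologicalType) (A : set S) (B : set T) :
  open A -> open B -> open (A `*` B).
Proof.
move=> oA oB; rewrite (_ : A `*` B = fst @^-1` A `&` snd @^-1` B) //.
by apply: openI; apply: open_comp => // z _; [exact: cvg_fst|exact: cvg_snd].
Qed.

Lemma hausdorff_setX (S T : topologicalType) :
  hausdorff_space S -> hausdorff_space T -> hausdorff_space (S * T)%type.
Proof.
move=> hS hT [a b] [a' b'] cl; congr (_, _).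
- apply: hS => A B aA bB.
  have [||z [[/= zA _] [/= zB _]]] := cl (A `*` setT) (B `*` setT).
  + by exists (A, setT) => //; split => //; exact: filterT.
  + by exists (B, setT) => //; split => //; exact: filterT.
  by exists z.1.
- apply: hT => A B aA bB.
  have [||z [[/= _ zA] [/= _ zB]]] := cl (setT `*` A) (setT `*` B).
  + by exists (setT, A) => //; split => //; exact: filterT.
  + by exists (setT, B) => //; split => //; exact: filterT.
  by exists z.2.
Qed.

Lemma noncommuting_nbhs (K : topologicalGroupType) (x y : K) :
  locally_compact_group K -> (x * y <> y * x)%g ->
  exists U W : set K, [/\ open_nbhs x U, open_nbhs y W,
    exists2 C, compact C & U `<=` C, exists2 C, compact C & W `<=` C &
    forall u w u' w', U u -> W w -> U u' -> W w' -> (u * w <> w' * u')%g].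
Proof.
move=> lcK xy; have [hK _] := lcK.
move: (hK); rewrite open_hausdorff => /(_ (x * y)%g (y * x)%g).
case; first exact/eqP.
move=> [P Q] /= [/set_mem xP /set_mem yQ] [oP oQ /eqP PQ].
have nP : nbhs (x, y) (fun p : K * K => P (p.1 * p.2)%g).
  by apply: (mulg_continuous (x, y)); exact: open_nbhs_nbhs.
have nQ : nbhs (y, x) (fun p : K * K => Q (p.1 * p.2)%g).
  by apply: (mulg_continuous (y, x)); exact: open_nbhs_nbhs.
have [[U1 W1] /= [xU1 yW1] UW1] := nP.
have [[W2 U2] /= [yW2 xU2] WU2] := nQ.
have [C cC xC] := locally_compact_group_nbhs x lcK.
have [D cD yD] := locally_compact_group_nbhs y lcK.
exists (C `&` U1 `&` U2)^°, (D `&` W1 `&` W2)^°; split.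
- by split; [exact: open_interior|do !apply: filterI].
- by split; [exact: open_interior|do !apply: filterI].
- by exists C => // z /interior_subset[[]].
- by exists D => // z /interior_subset[[]].
move=> u w u' w' /interior_subset[[_ Uu] _] /interior_subset[[_ Ww] _].
move=> /interior_subset[_ Uu'] /interior_subset[_ Ww'] eq.
have : (P `&` Q) (u * w)%g.
  by split; [exact: (UW1 (u, w))|rewrite eq; exact: (WU2 (w', u'))].
by rewrite PQ.
Qed.

Section NonabelianTau.
Context {R : realType} {H K : topologicalGroupType}.
Hypotheses (lcH : locally_compact_group H) (lcK : locally_compact_group K).
Variable tau : continuousAction H K.
Variables (muH : {measure set (borel H) -> \bar R}).
Variables (muK : {measure set (borel K) -> \bar R}).
Hypotheses (haarH : left_haar_measure muH) (haarK : left_haar_measure muK).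
Variable delta : H -> R.
Hypothesis delta_cont : continuous delta.
Local Notation G := (semidirect tau).

Definition box_indic (A : set H) (U : set K) : G -> R[i] :=
  fun z => (\1_(A `*` U) z : R)%:C%C.

Variables (A : set H) (U W : set K).
Hypotheses (oA : open A) (oU : open U) (oW : open W).

(** All integrands vanish: with s in W and s^-1 k in U, the product k would lie in
    W U. *)
Lemma tau_conv_box_eq0 h k :
  (forall u w, U u -> W w -> k <> (w * u)%g) ->
  tau_conv muH muK delta (box_indic A W) (box_indic A U) (h, k) = 0.
Proof.
move=> kWU.
have conv0 t t' :
    convolution muK (slice (box_indic A W) t) (slice (box_indic A U) t') k = 0.
  rewrite /convolution -[RHS]/((0 : R)%:C%C).
  rewrite (_ : (fun s : borel K => _) = fun s : borel K => (0 : R)%:C%C).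
    by rewrite cintegral_real /Rintegral integral0.
  apply/funext => s; rewrite /slice /box_indic -rmorphM !indicE /=.
  case: (boolP ((t, s : K) \in _)); last by rewrite mul0r.
  rewrite inE => -[_ /= Ws]; rewrite mul1r memNset // => -[_ /= Us].
  by apply: (kWU _ _ Us Ws); rewrite mulVKg.
have int0 : cintegral muH (fun=> 0) = 0 :> R[i].
  rewrite (cintegral_real muH (fun=> 0)) /Rintegral integral0; exact: rmorph0.
rewrite /tau_conv /tau_conv_r /tau_conv_l /=.
rewrite (_ : (fun t : borel H => _) = fun=> 0); last first.
  by apply/funext => t; rewrite conv0 mul0r.
rewrite (_ : (fun t : borel H => _) = fun=> 0); last first.
  by apply/funext => t; rewrite conv0 mul0r.
by rewrite int0 addr0 mulr0.
Qed.

Hypotheses (cptU : exists2 C, compact C & U `<=` C)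
  (cptA : exists2 C, compact C & A `<=` C).
Variable c : R.
Hypotheses (c_gt0 : 0 < c) (delta_A : forall t, A t -> c^-1 <= delta t <= c).

(** At (h, k) with h in A and k = u w, both halves of the tau-convolution equal
    b times the integral of delta over A, where b > 0 is the measure of the
    nonempty open set B of all s in U with s^-1 k in W. *)
Lemma tau_conv_box_neq0 h u w : A h -> U u -> W w ->
  tau_conv muH muK delta (box_indic A U) (box_indic A W) (h, (u * w)%g) != 0.
Proof.
move=> Ah Uu Ww; set k := (u * w)%g.
pose B : set K := U `&` (fun s => (s^-1 * k)%g) @^-1` W.
have oB : open B.
  apply: openI => //; apply: open_comp => // s _.
  apply: mulg2_continuous => [|z]; last exact: cvg_cst.
  by apply: invg_comp_continuous => z; exact: cvg_id.
pose b : R := \int[muK]_s \1_(B : set (borel K)) s.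
have b0 : 0 < b.
  apply: (@Rintegral_pinched_gt0 _ _ _ muK B _ 1 1) => //.
  - exact: open_borel.
  - apply: (haar_open_gt0_lty haarK (x := u)) => //.
      by split=> //=; rewrite /k mulKg.
    by have [C cC UC] := cptU; exists C => // s [/UC].
  - by apply: measurable_indic; exact: open_borel.
  - by move=> s; rewrite mul1r lexx.
pose F (t : borel H) : R := b * (\1_A t * delta t).
have F0 : 0 < \int[muH]_t F t.
  apply: (@Rintegral_pinched_gt0 _ _ _ muH A _ (b * c^-1) (b * c)) => //.
  - exact: open_borel.
  - exact: (haar_open_gt0_lty haarH (x := h)).
  - apply: measurable_funM => //; apply: measurable_funM.
      by apply: measurable_indic; exact: open_borel.
    exact: measurable_continuous_real.
  - by rewrite mulr_gt0 // invr_gt0.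
  - move=> t; rewrite /F indicE; case: (boolP (t \in A)) => [/set_mem At|_].
      by rewrite !mulr1 mul1r !ler_pM2l //; exact: delta_A.
    by rewrite !mulr0 mul0r mulr0 lexx.
have conv t t' :
    convolution muK (slice (box_indic A U) t) (slice (box_indic A W) t') k =
    (b * (\1_A t * \1_A t'))%:C%C.
  rewrite /convolution.
  rewrite (_ : (fun s : borel K => _) =
      fun s : borel K => (\1_B s * (\1_A t * \1_A t') : R)%:C%C).
    rewrite cintegral_real; congr real_complex_def.
    have [->|->] : \1_A t * \1_A t' = 0 :> R \/ \1_A t * \1_A t' = 1 :> R.
        rewrite !indicE -natrM.
        by case: (t \in A); case: (t' \in A); [right|left..].
      by rewrite mulr0 /Rintegral integral0_eq // => s _; rewrite mulr0.
    by rewrite mulr1; apply: eq_Rintegral => s _; rewrite mulr1.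
  apply/funext => s; rewrite /slice /box_indic -rmorphM; congr real_complex_def.
  rewrite !indicE !in_setX in_setI.
  rewrite (_ : (s \in _ @^-1` W) = (((s : K)^-1 * k)%g \in W)) //.
  by rewrite -!natrM !mulnb andbACA andbC.
have intF (Z : borel H -> R[i]) : (forall t, Z t = (F t)%:C%C) ->
    cintegral muH Z = (\int[muH]_t F t)%:C%C.
  by move=> ZF; rewrite -cintegral_real; congr cintegral; apply/funext.
have A1 : \1_A h = 1 :> R by rewrite indicE mem_set.
rewrite /tau_conv /tau_conv_r /tau_conv_l /= !intF; first last.
- by move=> t; rewrite conv A1 mul1r -rmorphM -mulrA.
- by move=> t; rewrite conv A1 mulr1 -rmorphM -mulrA.
rewrite mulf_neq0 ?invr_neq0 ?pnatr_eq0 // -rmorphD fmorph_eq0.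
by rewrite lt0r_neq0 // addr_gt0.
Qed.

End NonabelianTau.

Lemma box_indic_integrable (R : realType) (H K : topologicalGroupType)
    (tau : continuousAction H K)
    (mu : {measure set (borel (semidirect tau)) -> \bar R}) (A : set H) (U : set K) :
  left_haar_measure mu -> hausdorff_space H -> hausdorff_space K ->
  open A -> open U -> (exists2 C, compact C & A `<=` C) ->
  (exists2 C, compact C & U `<=` C) ->
  cintegrable mu (box_indic (R := R) (tau := tau) A U).
Proof.
move=> haar hH hK oA oU [C cC AC] [D cD UD].
have mAU : measurable (A `*` U : set (borel (semidirect tau))).
  by apply: open_borel; exact: open_setX.
apply: cintegrable_indic => //.
have cCD : compact (C `*` D : set (semidirect tau)) by exact: compact_setX.
have [[fin _ _] _ _] := haar.
apply: le_lt_trans (fin _ cCD); apply: le_measure; rewrite ?inE //.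
  by apply: compact_borel cCD; exact: hausdorff_setX.
by move=> z [Az Uz]; split; [exact: AC|exact: UD].
Qed.

Theorem theorem3p16 (R : realType) (H K : topologicalGroupType)
    (lcH : locally_compact_group H) (lcK : locally_compact_group K)
    (tau : continuousAction H K)
    (muH : {measure set (borel H) -> \bar R})
    (muK : {measure set (borel K) -> \bar R})
    (haarH : left_haar_measure muH) (haarK : left_haar_measure muK)
    (delta : H -> R) (delta_tau : modular_factor tau muK delta)
    (mu : {measure set (borel (semidirect tau)) -> \bar R})
    (haarG : semidirect_haar_measure muH muK delta mu) :
  (forall f g : borel (semidirect tau) -> R[i],
     cintegrable mu f -> cintegrable mu g ->
     {ae mu, forall x, tau_conv muH muK delta f g x = tau_conv muH muK delta g f x})
  <-> (forall x y : K, commute x y).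
Proof.
split=> [comm x y|ab f g _ _]; last first.
  by apply: aeW => x; exact: abelian_tau_convC haarK lcK ab.
apply: contrapT => xy; have [hH _] := lcH; have [hK _] := lcK.
have [U [W [[oU Ux] [oW Wy] cptU cptW UW]]] := noncommuting_nbhs lcK xy.
have [delta_gt0 _ delta_cont _] := delta_tau.
have [C cC C1] := locally_compact_group_nbhs 1%g lcH.
(* Bounding delta between c^-1 and c on A makes its integral over A finite and
   positive; c is chosen so that these bounds hold strictly at 1. *)
pose c := delta 1%g + (delta 1%g)^-1.
have d1 : delta 1%g < c by rewrite ltrDl invr_gt0.
have c_gt0 : 0 < c by exact: lt_trans d1.
have d1V : c^-1 < delta 1%g.
  by rewrite invf_plt ?posrE //; rewrite ltrDr.
pose A : set H := C^° `&` delta @^-1` [set r | c^-1 < r < c].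
have oA : open A.
  apply: openI; first exact: open_interior.
  apply: open_comp; first by move=> t _; exact: delta_cont.
  rewrite (_ : [set r | _] = [set` `]c^-1, c[]); first exact: interval_open.
  by apply/seteqP; split => r; rewrite /= in_itv.
have A1 : A 1%g by split=> //=; rewrite d1V d1.
have cptA : exists2 C, compact C & A `<=` C.
  by exists C => // t [/interior_subset].
have delta_A t : A t -> c^-1 <= delta t <= c.
  by move=> [_ /= /andP[l1 l2]]; rewrite !ltW.
have [haarM _] := haarG.
have intU := box_indic_integrable haarM hH hK oA oU cptA cptU.
have intW := box_indic_integrable haarM hH hK oA oW cptA cptW.
have [N [mN N0 sub]] := comm _ _ intU intW.
(* P is the product set U W. *)
pose P : set K := \bigcup_(u in U) (fun k => (u^-1 * k)%g) @^-1` W.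
have oP : open P.
  apply: bigcup_open => u _.
  by apply: open_comp => // k _; exact: mulgl_continuous.
have AP : (A `*` P : set (semidirect tau)) (1%g, (x * y)%g).
  by split=> //; exists x => //=; rewrite mulKg.
have oAP : open (A `*` P : set (semidirect tau)) by exact: open_setX.
have := haar_open_gt0 haarM (hausdorff_setX hH hK) oAP AP.
apply/negP; rewrite -leNgt -N0; apply: le_measure; rewrite ?inE //.
  exact: open_borel.
move=> [h k] [/= Ah [u Uu Wk]]; apply: sub => /=.
have kE : k = (u * (u^-1 * k))%g by rewrite mulVKg.
rewrite [X in _ = X]tau_conv_box_eq0; last first.
  by move=> u' w' Uu' Ww'; rewrite kE; exact: UW.
rewrite kE; apply/eqP.
exact: (tau_conv_box_neq0 lcH lcK tau haarH haarK delta_cont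
  oA oU oW cptU cptA c_gt0 delta_A).
Qed.
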